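(* Let $E,F$ be two Lie algebroids over a smooth manifold $M$, let $K\colon E\to F$ be a morphism of Lie algebroids, and let $(\nabla,\zeta)$ be a strict $K$-adjustment on $E$. Then the direct sum $A:=F\oplus E$ is a Lie algebroid (denoted $F\bowtie_{(\nabla,\zeta)}E$) with anchor $\rho_A(X,\mu)=\rho_F(X)+\rho_E(\mu)$ and bracket given, for all $(X,\mu),(Y,\nu)\in\Gamma(A)$, by $$[(X,\mu),(Y,\nu)]_A:=\Bigl([X+K(\mu),Y+K(\nu)]_F-K\bigl([\mu,\nu]_E+\nabla_X\nu-\nabla_Y\mu+\zeta(X,Y)\bigr),\ [\mu,\nu]_E+\nabla_X\nu-\nabla_Y\mu+\zeta(X,Y)\Bigr),$$ and this equals $$\Bigl([X,Y]_F+\nabla^{\mathrm{bas}}_\mu Y-\nabla^{\mathrm{bas}}_\nu X-K(\zeta(X,Y)),\ [\mu,\nu]_E+\nabla_X\nu-\nabla_Y\mu+\zeta(X,Y)\Bigr).$$ In particular, for all $\mu,\nu\in\Gamma(E)$, $$[(-K(\mu),\mu),(-K(\nu),\nu)]_A=\bigl(-K(H(\mu,\nu)),H(\mu,\nu)\bigr),\qquad\text{where } H(\mu,\nu)=t_{\nabla^{\mathrm{bas}}}(\mu,\nu)+\zeta\bigl(K(\mu),K(\nu)\bigr).$$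
   Context: Everything is smooth. For a Lie algebroid $A\to M$, $\rho_A$ is its anchor and $[\cdot,\cdot]_A$ its bracket. Morphisms of Lie algebroids over $M$ cover the identity. For a Lie algebroid $F$ and a vector bundle $E$ over $M$, an $F$-connection on $E$ is an $\mathbb R$-bilinear map $\nabla\colon\Gamma(F)\times\Gamma(E)\to\Gamma(E)$, $C^\infty(M)$-linear in the first argument, with $\nabla_X(f\mu)=f\nabla_X\mu+(\rho_F(X)f)\mu$. Its curvature is $R_\nabla(X,Y)\mu=\nabla_X\nabla_Y\mu-\nabla_Y\nabla_X\mu-\nabla_{[X,Y]_F}\mu$. Put $\Omega^k(F;E)=\Gamma(\bigwedge^kF^*\otimes E)$; for $\zeta\in\Omega^2(F;E)$, $(\mathrm d^\nabla\zeta)(X,Y,Z)=\sum_{\mathrm{cyc}(X,Y,Z)}\bigl(\nabla_X(\zeta(Y,Z))-\zeta([X,Y]_F,Z)\bigr)$. Let $E,F\to M$ be Lie algebroids, $K\colon E\to F$ a morphism of Lie algebroids and $\nabla$ an $F$-connection on $E$. The basic $K$-connection $\nabla^{\mathrm{bas}}$ of $\nabla$ is the pair of $E$-connections, on $E$ and on $F$, given by $\nabla^{\mathrm{bas}}_\mu\nu=[\mu,\nu]_E+\nabla_{K(\nu)}\mu$ and $\nabla^{\mathrm{bas}}_\mu X=[K(\mu),X]_F+K(\nabla_X\mu)$. Its torsion (on $E$) is $t_{\nabla^{\mathrm{bas}}}(\mu,\nu)=\nabla^{\mathrm{bas}}_\mu\nu-\nabla^{\mathrm{bas}}_\nu\mu-[\mu,\nu]_E$.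 $\nabla$ is a Cartan $K$-connection if for all $\mu,\nu\in\Gamma(E)$, $X\in\Gamma(F)$: $\nabla_X([\mu,\nu]_E)-[\nabla_X\mu,\nu]_E-[\mu,\nabla_X\nu]_E-\nabla_{\nabla^{\mathrm{bas}}_\nu X}\mu+\nabla_{\nabla^{\mathrm{bas}}_\mu X}\nu=0$. For $\zeta\in\Omega^2(F;E)$ put $\nabla^\zeta_X\nu=\nabla_X\nu-\zeta(X,K(\nu))$. A $K$-adjustment is a pair $(\nabla,\zeta)$ with $\nabla$ a Cartan $K$-connection and $\zeta\in\Omega^2(F;E)$ such that $R_\nabla(X,Y)\nu=-\nabla^{\mathrm{bas}}_\nu(\zeta(X,Y))+\zeta(\nabla^{\mathrm{bas}}_\nu X,Y)+\zeta(X,\nabla^{\mathrm{bas}}_\nu Y)$ for all $X,Y\in\Gamma(F)$, $\nu\in\Gamma(E)$. It is strict if $\mathrm d^{\nabla^\zeta}\zeta=0$. *)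

(* Defs.v *)
From HB Require Import structures.
From mathcomp Require Import all_boot all_order all_algebra.
From mathcomp Require Import all_classical all_reals all_analysis.

Set Implicit Arguments.
Unset Strict Implicit.
Unset Printing Implicit Defensive.
Import Order.TTheory GRing.Theory Num.Theory.
Import numFieldNormedType.Exports.

Local Open Scope classical_set_scope.
Local Open Scope ring_scope.

(* [O] is meant to be open: [derive] is total, and on an open set its value
   only depends on [f] restricted to that set. *)
Fixpoint Ck (R : realType) (n k : nat) (O : set 'rV[R]_n) (f : 'rV[R]_n -> R)
    : Prop :=
  (forall x, O x -> {for x, continuous f}) /\
  match k with
  | 0 => True
  | k'.+1 => forall i : 'I_n,
      (forall x, O x -> derivable f x (delta_mx 0 i)) /\
      Ck k' O (fun x => derive f x (delta_mx 0 i))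
  end.

Definition Cinfty (R : realType) (n : nat) (O : set 'rV[R]_n)
    (f : 'rV[R]_n -> R) : Prop := forall k, Ck k O f.

Section CinftyTheory.
Context {R : realType} {n : nat}.
Implicit Types (O : set 'rV[R]_n) (f g : 'rV[R]_n -> R).

Lemma CkS k O f : Ck k.+1 O f -> Ck k O f.
Proof.
elim: k f => [|k IH] f [cf df]; first by split.
by split=> // i; have [d1 d2] := df i; split=> //; apply: IH.
Qed.

Lemma eq_Ck k O f g : open O -> (forall x, O x -> f x = g x) ->
  Ck k O f -> Ck k O g.
Proof.
move=> oO; elim: k f g => [|k IH] f g fg [cf df].
all: have nfg x : O x -> \near x, f x = g x
  by move=> Ox; near=> y; apply: fg; near: y; exact: open_nbhs_nbhs.
all: have cg x : O x -> {for x, continuous g}.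
1,3: move=> Ox; have := cvg_trans (near_eq_cvg (nfg x Ox)) (cf x Ox).
1,2: by rewrite (fg x Ox) => h; exact: h.
  by [].
split=> // i; have [d1 d2] := df i; split.
  by move=> x Ox; apply: near_eq_derivable (d1 x Ox); exact: nfg.
by apply: IH d2 => x Ox; apply: near_eq_derive; exact: nfg.
Unshelve. all: by end_near. Qed.

Lemma Ck_subset k O (O' : set 'rV[R]_n) f : O' `<=` O -> Ck k O f -> Ck k O' f.
Proof.
move=> sO; elim: k f => [|k IH] f [cf df].
  by split=> // x /sO; exact: cf.
split=> [x /sO|i]; first exact: cf.
by have [d1 d2] := df i; split; [move=> x /sO; exact: d1 | exact: IH].
Qed.

Lemma Ck_cst k O (c : R) : open O -> Ck k O (fun=> c).
Proof.
move=> oO; elim: k c => [|k IH] c.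
  by split=> // x _; exact: cst_continuous.
split=> [x _|i]; first exact: cst_continuous.
split=> [x _|]; first exact: derivable_cst.
apply: (@eq_Ck _ _ (fun=> 0)) => // x _.
by rewrite derive_cst.
Qed.

Lemma CkD k O f g : open O -> Ck k O f -> Ck k O g ->
  Ck k O (fun x => f x + g x).
Proof.
move=> oO; elim: k f g => [|k IH] f g [cf df] [cg dg].
  by split=> // x Ox; exact: (cvgD (cf x Ox) (cg x Ox)).
split=> [x Ox|i]; first exact: (cvgD (cf x Ox) (cg x Ox)).
have [f1 f2] := df i; have [g1 g2] := dg i; split.
  by move=> x Ox; apply: derivableD; [exact: f1|exact: g1].
apply: eq_Ck (IH _ _ f2 g2) => // x Ox.
by rewrite -deriveD//; [exact: f1|exact: g1].
Qed.

Lemma CkM k O f g : open O -> Ck k O f -> Ck k O g ->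
  Ck k O (fun x => f x * g x).
Proof.
move=> oO; elim: k f g => [|k IH] f g Cf Cg.
  case: Cf Cg => cf _ [cg _].
  by split=> // x Ox; exact: (cvgM (cf x Ox) (cg x Ox)).
have [[cf df] [cg dg]] := (Cf, Cg); split=> [x Ox|i].
  exact: (cvgM (cf x Ox) (cg x Ox)).
have [f1 f2] := df i; have [g1 g2] := dg i; split.
  by move=> x Ox; apply: derivableM; [exact: f1|exact: g1].
have := CkD oO (IH _ _ (CkS Cf) g2) (IH _ _ (CkS Cg) f2).
apply: eq_Ck => // x Ox.
by rewrite -[RHS]/(derive (f * g) x _) deriveM//; [exact: f1|exact: g1].
Qed.

End CinftyTheory.

Record manifold (R : realType) := Manifold {
  mcarrier :> topologicalType;
  mdim : nat;
  mhausdorff : hausdorff_space mcarrier;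
  msecond_countable : @second_countable mcarrier;
  chart : Type;
  cdom : chart -> set mcarrier;
  cmap : chart -> mcarrier -> 'rV[R]_mdim;
  cinv : chart -> 'rV[R]_mdim -> mcarrier;
  cdom_open : forall c, open (cdom c);
  cimg_open : forall c, open (cmap c @` cdom c);
  cmapK : forall c x, cdom c x -> cinv c (cmap c x) = x;
  cmap_continuous : forall c x, cdom c x -> {for x, continuous (cmap c)};
  cinv_continuous : forall c v, (cmap c @` cdom c) v ->
    {for v, continuous (cinv c)};
  chart_cover : forall x, exists c, cdom c x;
  chart_transition : forall c d (k : 'I_mdim),
    Cinfty (cmap c @` (cdom c `&` cdom d)) (fun v => cmap d (cinv c v) 0 k)
}.

Section SmoothFunctions.
Context {R : realType} (M : manifold R).

Definition smooth_on (U : set M) (f : M -> R) : Prop :=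
  forall c : chart M,
    Cinfty (cmap c @` (cdom c `&` U)) (fun v => f (cinv c v)).

Lemma open_cimg (c : chart M) (U : set M) : open U ->
  open (cmap c @` (cdom c `&` U)).
Proof.
move=> oU.
have -> : cmap c @` (cdom c `&` U) =
    (cmap c @` cdom c) `&` (cinv c @^-1` U).
  apply/seteqP; split=> [_ [x [cx Ux] <-]|v [[x cx <-]]] /=.
    by split; [exists x|rewrite /= cmapK].
  by rewrite cmapK// => Ux; exists x.
rewrite openE => v [vc vU].
apply: filterI.
  by apply: open_nbhs_nbhs; split=> //; exact: cimg_open.
by apply: (cinv_continuous vc); apply: open_nbhs_nbhs.
Qed.

Lemma smooth_onS (U V : set M) f : V `<=` U -> smooth_on U f -> smooth_on V f.
Proof.
move=> VU sf c k; apply: Ck_subset (sf c k) => _ [x [cx /VU Ux] <-].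
by exists x.
Qed.

Lemma smooth_on_cst (U : set M) a : open U -> smooth_on U (fun=> a).
Proof. by move=> oU c k; apply: Ck_cst; exact: open_cimg. Qed.

Lemma smooth_onD (U : set M) f g : open U ->
  smooth_on U f -> smooth_on U g -> smooth_on U (fun x => f x + g x).
Proof.
by move=> oU sf sg c k; exact: (CkD (open_cimg oU) (sf c k) (sg c k)).
Qed.

Lemma smooth_onM (U : set M) f g : open U ->
  smooth_on U f -> smooth_on U g -> smooth_on U (fun x => f x * g x).
Proof.
by move=> oU sf sg c k; exact: (CkM (open_cimg oU) (sf c k) (sg c k)).
Qed.

Lemma eq_smooth_on (U : set M) f g : open U -> (forall x, U x -> f x = g x) ->
  smooth_on U f -> smooth_on U g.
Proof.
move=> oU fg sf c k; apply: eq_Ck (sf c k); first exact: open_cimg.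
by move=> _ [x [cx Ux] <-]; rewrite cmapK//; exact: fg.
Qed.

Record sfun := SFun { sfun_val :> M -> R; sfunP : smooth_on setT sfun_val }.

Lemma sfun_eq (f g : sfun) : (forall x, f x = g x) -> f = g.
Proof.
case: f g => f sf [g sg] /= /funext fg; rewrite fg in sf *.
by congr SFun; exact: Prop_irrelevance.
Qed.

HB.instance Definition _ := gen_eqMixin sfun.
HB.instance Definition _ := gen_choiceMixin sfun.

Definition sfun_cst (a : R) : sfun := SFun (smooth_on_cst a openT).
Definition sfun_add (f g : sfun) : sfun :=
  SFun (smooth_onD openT (@sfunP f) (@sfunP g)).
Definition sfun_mul (f g : sfun) : sfun :=
  SFun (smooth_onM openT (@sfunP f) (@sfunP g)).
Definition sfun_opp (f : sfun) : sfun := sfun_mul (sfun_cst (-1)) f.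

Fact sfun_addA : associative sfun_add.
Proof. by move=> f g h; apply: sfun_eq => x /=; rewrite addrA. Qed.
Fact sfun_addC : commutative sfun_add.
Proof. by move=> f g; apply: sfun_eq => x /=; rewrite addrC. Qed.
Fact sfun_add0 : left_id (sfun_cst 0) sfun_add.
Proof. by move=> f; apply: sfun_eq => x /=; rewrite add0r. Qed.
Fact sfun_addN : left_inverse (sfun_cst 0) sfun_opp sfun_add.
Proof. by move=> f; apply: sfun_eq => x /=; rewrite mulN1r addNr. Qed.
HB.instance Definition _ :=
  GRing.isZmodule.Build sfun sfun_addA sfun_addC sfun_add0 sfun_addN.

Fact sfun_mulA : associative sfun_mul.
Proof. by move=> f g h; apply: sfun_eq => x /=; rewrite mulrA. Qed.
Fact sfun_mulC : commutative sfun_mul.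
Proof. by move=> f g; apply: sfun_eq => x /=; rewrite mulrC. Qed.
Fact sfun_mul1 : left_id (sfun_cst 1) sfun_mul.
Proof. by move=> f; apply: sfun_eq => x /=; rewrite mul1r. Qed.
Fact sfun_mulDl : left_distributive sfun_mul +%R.
Proof. by move=> f g h; apply: sfun_eq => x /=; rewrite mulrDl. Qed.
HB.instance Definition _ :=
  GRing.Zmodule_isComPzRing.Build sfun sfun_mulA sfun_mulC sfun_mul1 sfun_mulDl.

(* The tangent space at [x], as the space of derivations at [x] of the algebra
   of smooth functions on [M]. *)
Record tangent (x : M) := Tangent {
  tangent_val :> sfun -> R;
  tangentD : forall f g, tangent_val (f + g) = tangent_val f + tangent_val g;
  tangentZ : forall a f, tangent_val (sfun_cst a * f) = a * tangent_val f;
  tangentM : forall f g,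
    tangent_val (f * g) = f x * tangent_val g + g x * tangent_val f
}.

Section TangentSpace.
Variable x : M.

Lemma tangent_eq (v w : tangent x) : (forall f, v f = w f) -> v = w.
Proof.
case: v w => v v1 v2 v3 [w w1 w2 w3] /= /funext vw.
by rewrite vw in v1 v2 v3 *; congr Tangent; exact: Prop_irrelevance.
Qed.

HB.instance Definition _ := gen_eqMixin (tangent x).
HB.instance Definition _ := gen_choiceMixin (tangent x).

Definition tangent_zero : tangent x.
Proof.
exists (fun=> 0) => [f g|a f|f g]; first by rewrite addr0.
  by rewrite mulr0.
by rewrite !mulr0 addr0.
Defined.

Definition tangent_add (v w : tangent x) : tangent x.
Proof.
exists (fun f => v f + w f) => [f g|a f|f g].
- by rewrite !tangentD addrACA.
- by rewrite !tangentZ mulrDr.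
- by rewrite !tangentM !mulrDr addrACA.
Defined.

Definition tangent_scale (a : R) (v : tangent x) : tangent x.
Proof.
exists (fun f => a * v f) => [f g|b f|f g].
- by rewrite tangentD mulrDr.
- by rewrite tangentZ mulrCA.
- by rewrite tangentM mulrDr ![a * (_ * _)]mulrCA.
Defined.

Definition tangent_opp (v : tangent x) : tangent x := tangent_scale (-1) v.

Fact tangent_addA : associative tangent_add.
Proof. by move=> u v w; apply: tangent_eq => f /=; rewrite addrA. Qed.
Fact tangent_addC : commutative tangent_add.
Proof. by move=> u v; apply: tangent_eq => f /=; rewrite addrC. Qed.
Fact tangent_add0 : left_id tangent_zero tangent_add.
Proof. by move=> u; apply: tangent_eq => f /=; rewrite add0r. Qed.
Fact tangent_addN : left_inverse tangent_zero tangent_opp tangent_add.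
Proof. by move=> u; apply: tangent_eq => f /=; rewrite mulN1r addNr. Qed.
HB.instance Definition _ := GRing.isZmodule.Build (tangent x)
  tangent_addA tangent_addC tangent_add0 tangent_addN.

Fact tangent_scaleA a b v :
  tangent_scale a (tangent_scale b v) = tangent_scale (a * b) v.
Proof. by apply: tangent_eq => f /=; rewrite mulrA. Qed.
Fact tangent_scale1 : left_id 1 tangent_scale.
Proof. by move=> v; apply: tangent_eq => f /=; rewrite mul1r. Qed.
Fact tangent_scaleDr : right_distributive tangent_scale +%R.
Proof. by move=> a u v; apply: tangent_eq => f /=; rewrite mulrDr. Qed.
Fact tangent_scaleDl v : {morph tangent_scale^~ v : a b / a + b}.
Proof. by move=> a b; apply: tangent_eq => f /=; rewrite mulrDl. Qed.
HB.instance Definition _ := GRing.Zmodule_isLmodule.Build R (tangent x)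
  tangent_scaleA tangent_scale1 tangent_scaleDr tangent_scaleDl.

End TangentSpace.

(* Global test functions suffice, since [M] has smooth bump functions. *)
Definition smooth_field_on (U : set M) (v : forall x, tangent x) : Prop :=
  forall f : sfun, smooth_on U (fun x => v x f).

(* A vector bundle is given by its fibres and a family of local
   trivialisations, fibrewise linear isomorphisms onto ['rV[R]_r], whose
   transition functions are smooth; this data determines the topology and the
   smooth structure of the total space.  The rank is locally constant. *)
Record vbundle := VBundle {
  fibre :> M -> lmodType R;
  trivialisation : Type;
  tdom : trivialisation -> set M;
  trank : trivialisation -> nat;
  tmap : forall i x, fibre x -> 'rV[R]_(trank i);
  tinv : forall i x, 'rV[R]_(trank i) -> fibre x;
  tdom_open : forall i, open (tdom i);
  tmap_linear : forall i x, tdom i x -> linear (@tmap i x);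
  tmapK : forall i x, tdom i x -> cancel (@tmap i x) (@tinv i x);
  tinvK : forall i x, tdom i x -> cancel (@tinv i x) (@tmap i x);
  triv_cover : forall x, exists i, tdom i x;
  triv_transition : forall i j (v : 'rV[R]_(trank i)) (k : 'I_(trank j)),
    smooth_on (tdom i `&` tdom j) (fun x => @tmap j x (@tinv i x v) 0 k)
}.
Arguments tmap {E} i {x} : rename.
Arguments tinv {E} i x : rename.

Definition smooth_sec_on (E : vbundle) (U : set M) (s : forall x, E x) : Prop :=
  forall (i : trivialisation E) (k : 'I_(trank i)),
    smooth_on (tdom i `&` U) (fun x => tmap i (s x) 0 k).

Record Gamma (E : vbundle) := Section_ {
  sec_val :> forall x, E x;
  secP : smooth_sec_on setT sec_val
}.

Section Sections.
Variable E : vbundle.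

Lemma sec_eq (s t : Gamma E) : (forall x, s x = t x) -> s = t.
Proof.
case: s t => s ss [t st] /= st_eq.
have e : s = t by exact: functional_extensionality_dep.
by subst t; congr Section_; exact: Prop_irrelevance.
Qed.

HB.instance Definition _ := gen_eqMixin (Gamma E).
HB.instance Definition _ := gen_choiceMixin (Gamma E).

Let otd (i : trivialisation E) : open (tdom i `&` setT).
Proof. by rewrite setIT; exact: tdom_open. Qed.

Lemma smooth_sec_lin (f : sfun) (s t : Gamma E) :
  smooth_sec_on setT (fun x => f x *: s x + t x).
Proof.
move=> i k.
have H : smooth_on (tdom i `&` setT)
    (fun x => f x * tmap i (s x) 0 k + tmap i (t x) 0 k).
  apply: smooth_onD; [exact: otd| |exact: secP].
  apply: smooth_onM; [exact: otd| |exact: secP].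
  by apply: smooth_onS (sfunP f).
apply: eq_smooth_on H; first exact: otd.
by move=> x [ix _]; rewrite (tmap_linear ix) !mxE.
Qed.

Lemma smooth_sec_zero : smooth_sec_on setT (fun x => 0 : E x).
Proof.
move=> i k; apply: (@eq_smooth_on _ (fun=> 0)); first exact: otd.
  move=> x [ix _]; pose z : E x := 0.
  have := tmap_linear ix (-1) z z.
  by rewrite scaleN1r addNr [z]/(0 : E x) scaleN1r addNr => ->; rewrite mxE.
by apply: smooth_on_cst; exact: otd.
Qed.

Definition sec_zero : Gamma E := Section_ smooth_sec_zero.

Lemma smooth_sec_add (s t : Gamma E) : smooth_sec_on setT (fun x => s x + t x).
Proof.
have := smooth_sec_lin (sfun_cst 1) s t.
by congr smooth_sec_on; apply: functional_extensionality_dep => x /=;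
  rewrite scale1r.
Qed.
Definition sec_add (s t : Gamma E) : Gamma E := Section_ (smooth_sec_add s t).

Lemma smooth_sec_scale (f : sfun) (s : Gamma E) :
  smooth_sec_on setT (fun x => f x *: s x).
Proof.
have := smooth_sec_lin f s sec_zero.
by congr smooth_sec_on; apply: functional_extensionality_dep => x /=;
  rewrite addr0.
Qed.
Definition sec_scale (f : sfun) (s : Gamma E) : Gamma E :=
  Section_ (smooth_sec_scale f s).
Definition sec_opp (s : Gamma E) : Gamma E := sec_scale (sfun_cst (-1)) s.

Fact sec_addA : associative sec_add.
Proof. by move=> r s t; apply: sec_eq => x /=; rewrite addrA. Qed.
Fact sec_addC : commutative sec_add.
Proof. by move=> s t; apply: sec_eq => x /=; rewrite addrC. Qed.
Fact sec_add0 : left_id sec_zero sec_add.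
Proof. by move=> s; apply: sec_eq => x /=; rewrite add0r. Qed.
Fact sec_addN : left_inverse sec_zero sec_opp sec_add.
Proof. by move=> s; apply: sec_eq => x /=; rewrite scaleN1r addNr. Qed.
HB.instance Definition _ := GRing.isZmodule.Build (Gamma E)
  sec_addA sec_addC sec_add0 sec_addN.

Fact sec_scaleA f g s : sec_scale f (sec_scale g s) = sec_scale (f * g) s.
Proof. by apply: sec_eq => x /=; rewrite scalerA. Qed.
Fact sec_scale1 : left_id 1 sec_scale.
Proof. by move=> s; apply: sec_eq => x /=; rewrite scale1r. Qed.
Fact sec_scaleDr : right_distributive sec_scale +%R.
Proof. by move=> f s t; apply: sec_eq => x /=; rewrite scalerDr. Qed.
Fact sec_scaleDl s : {morph sec_scale^~ s : f g / f + g}.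
Proof. by move=> f g; apply: sec_eq => x /=; rewrite scalerDl. Qed.
HB.instance Definition _ := GRing.Zmodule_isLmodule.Build sfun (Gamma E)
  sec_scaleA sec_scale1 sec_scaleDr sec_scaleDl.

End Sections.

(* Vector bundle morphisms over the identity of [M].  Here, and in [form2] and
   [anchor_map], smoothness is tested on local smooth sections; applied to a
   local frame it says that the matrix coefficients are smooth. *)
Record vbmorphism (E F : vbundle) := VBMorphism {
  vbm_val :> forall x, {linear E x -> F x};
  vbm_smooth : forall (U : set M) (s : forall x, E x), open U ->
    smooth_sec_on U s -> smooth_sec_on U (fun x => vbm_val x (s x))
}.

Definition vbm_sec (E F : vbundle) (K : vbmorphism E F) (s : Gamma E) :
    Gamma F :=
  Section_ (@vbm_smooth E F K setT s openT (secP s)).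

(* Sections of [\bigwedge^2 F^* \otimes E]. *)
Record form2 (F E : vbundle) := Form2 {
  form2_val :> forall x, F x -> F x -> E x;
  form2_linearl : forall x w, linear (fun v => @form2_val x v w);
  form2_linearr : forall x v, linear (@form2_val x v);
  form2_alternating : forall x v, @form2_val x v v = 0;
  form2_smooth : forall (U : set M) (s t : forall x, F x), open U ->
    smooth_sec_on U s -> smooth_sec_on U t ->
    smooth_sec_on U (fun x => @form2_val x (s x) (t x))
}.

Definition form2_sec (F E : vbundle) (zeta : form2 F E) (X Y : Gamma F) :
    Gamma E :=
  Section_ (@form2_smooth F E zeta setT X Y openT (secP X) (secP Y)).

Section DirectSum.
Variables F E : vbundle.

Definition dsum_index := (trivialisation F * trivialisation E)%type.
Definition dsum_dom (i : dsum_index) := tdom i.1 `&` tdom i.2.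
Definition dsum_rank (i : dsum_index) := (trank i.1 + trank i.2)%N.
Definition dsum_map (i : dsum_index) (x : M) (v : (F x * E x)%type) :
    'rV[R]_(dsum_rank i) :=
  row_mx (tmap i.1 v.1) (tmap i.2 v.2).
Definition dsum_inv (i : dsum_index) (x : M) (v : 'rV[R]_(dsum_rank i)) :
    (F x * E x)%type :=
  (tinv i.1 x (lsubmx v), tinv i.2 x (rsubmx v)).

Fact dsum_dom_open i : open (dsum_dom i).
Proof. by apply: openI; exact: tdom_open. Qed.

Fact dsum_map_linear i x : dsum_dom i x -> linear (@dsum_map i x).
Proof.
move=> [ix jx] a u v.
rewrite /dsum_map /= (tmap_linear ix) (tmap_linear jx).
by rewrite scale_row_mx add_row_mx.
Qed.

Fact dsum_mapK i x : dsum_dom i x -> cancel (@dsum_map i x) (@dsum_inv i x).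
Proof.
by move=> [ix jx] [u v]; rewrite /dsum_inv /dsum_map row_mxKl row_mxKr !tmapK.
Qed.

Fact dsum_invK i x : dsum_dom i x -> cancel (@dsum_inv i x) (@dsum_map i x).
Proof.
by move=> [ix jx] v; rewrite /dsum_inv /dsum_map /= !tinvK// hsubmxK.
Qed.

Fact dsum_cover x : exists i, dsum_dom i x.
Proof.
have [[i ix] [j jx]] := (triv_cover F x, triv_cover E x).
by exists (i, j).
Qed.

Fact dsum_trans i j (v : 'rV[R]_(dsum_rank i)) (k : 'I_(dsum_rank j)) :
  smooth_on (dsum_dom i `&` dsum_dom j)
    (fun x => @dsum_map j x (@dsum_inv i x v) 0 k).
Proof.
rewrite /dsum_map /dsum_inv /=.
case: (split_ordP k) => l ->.
  rewrite (_ : (fun _ => _) =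
    (fun x => tmap j.1 (tinv i.1 x (lsubmx v)) 0 l)).
    by apply: smooth_onS (triv_transition (lsubmx v) l) => x [[? ?] [? ?]].
  by apply/funext => x; rewrite row_mxEl.
rewrite (_ : (fun _ => _) =
  (fun x => tmap j.2 (tinv i.2 x (rsubmx v)) 0 l)).
  by apply: smooth_onS (triv_transition (rsubmx v) l) => x [[? ?] [? ?]].
by apply/funext => x; rewrite row_mxEr.
Qed.

Definition dsum : vbundle :=
  @VBundle (fun x => (F x * E x)%type) dsum_index dsum_dom dsum_rank
    dsum_map dsum_inv
    dsum_dom_open dsum_map_linear dsum_mapK dsum_invK dsum_cover dsum_trans.

Lemma smooth_sec_pair (X : Gamma F) (mu : Gamma E) :
  @smooth_sec_on dsum setT (fun x => (X x, mu x)).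
Proof.
move=> i k; rewrite /= /dsum_map /=; case: (split_ordP k) => l ->.
  rewrite (_ : (fun _ => _) = (fun x => tmap i.1 (X x) 0 l)).
    by apply: smooth_onS (secP X l) => x [[? ?] ?].
  by apply/funext => x; rewrite row_mxEl.
rewrite (_ : (fun _ => _) = (fun x => tmap i.2 (mu x) 0 l)).
  by apply: smooth_onS (secP mu l) => x [[? ?] ?].
by apply/funext => x; rewrite row_mxEr.
Qed.

Definition sec_pair (X : Gamma F) (mu : Gamma E) : Gamma dsum :=
  Section_ (smooth_sec_pair X mu).

End DirectSum.

End SmoothFunctions.

Section LieAlgebroids.
Context {R : realType} {M : manifold R}.

Record anchor_map (E : vbundle M) := AnchorMap {
  anchor_val :> forall x : M, {linear E x -> tangent x};
  anchor_smooth : forall (U : set M) (s : forall x, E x), open U ->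
    smooth_sec_on U s -> smooth_field_on U (fun x => anchor_val x (s x))
}.

(* The action of the vector field [rho X] on smooth functions. *)
Definition anchor_act (E : vbundle M) (rho : anchor_map E) (X : Gamma E)
    (f : sfun M) : sfun M :=
  SFun (@anchor_smooth E rho setT X openT (secP X) f).

(* Real scalars act on sections through constant functions. *)
Record lie_algebroid (E : vbundle M) := LieAlgebroid {
  anchor : anchor_map E;
  bracket : Gamma E -> Gamma E -> Gamma E;
  bracketDl : forall X Y Z, bracket (X + Y) Z = bracket X Z + bracket Y Z;
  bracketDr : forall X Y Z, bracket X (Y + Z) = bracket X Y + bracket X Z;
  bracketZl : forall (a : R) X Y,
    bracket (sfun_cst M a *: X) Y = sfun_cst M a *: bracket X Y;
  bracketZr : forall (a : R) X Y,
    bracket X (sfun_cst M a *: Y) = sfun_cst M a *: bracket X Y;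
  bracketXX : forall X, bracket X X = 0;
  bracket_jacobi : forall X Y Z,
    bracket X (bracket Y Z) + bracket Y (bracket Z X)
      + bracket Z (bracket X Y) = 0;
  bracket_leibniz : forall X (f : sfun M) Y,
    bracket X (f *: Y) = f *: bracket X Y + anchor_act anchor X f *: Y;
  anchor_bracket : forall X Y (f : sfun M),
    anchor_act anchor (bracket X Y) f =
      anchor_act anchor X (anchor_act anchor Y f)
      - anchor_act anchor Y (anchor_act anchor X f)
}.

Definition is_la_morphism (E F : vbundle M) (LE : lie_algebroid E)
    (LF : lie_algebroid F) (K : vbmorphism E F) : Prop :=
  (forall x v, anchor LF x (K x v) = anchor LE x v) /\
  (forall mu nu : Gamma E,
     vbm_sec K (bracket LE mu nu) = bracket LF (vbm_sec K mu) (vbm_sec K nu)).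

Record connection (F : vbundle M) (LF : lie_algebroid F) (E : vbundle M) :=
  Connection {
  conn_val :> Gamma F -> Gamma E -> Gamma E;
  connDl : forall X Y mu, conn_val (X + Y) mu = conn_val X mu + conn_val Y mu;
  connZl : forall (f : sfun M) X mu, conn_val (f *: X) mu = f *: conn_val X mu;
  connDr : forall X mu nu, conn_val X (mu + nu) = conn_val X mu + conn_val X nu;
  connZr : forall X (a : R) mu,
    conn_val X (sfun_cst M a *: mu) = sfun_cst M a *: conn_val X mu;
  conn_leibniz : forall X (f : sfun M) mu,
    conn_val X (f *: mu) =
      f *: conn_val X mu + anchor_act (anchor LF) X f *: mu
}.

Section Adjustments.
Context {E F : vbundle M} (LE : lie_algebroid E) (LF : lie_algebroid F).
Variables (K : vbmorphism E F) (nabla : connection LF E) (zeta : form2 F E).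

Definition curvature (X Y : Gamma F) (nu : Gamma E) : Gamma E :=
  nabla X (nabla Y nu) - nabla Y (nabla X nu) - nabla (bracket LF X Y) nu.

Definition basE (mu nu : Gamma E) : Gamma E :=
  bracket LE mu nu + nabla (vbm_sec K nu) mu.

Definition basF (mu : Gamma E) (X : Gamma F) : Gamma F :=
  bracket LF (vbm_sec K mu) X + vbm_sec K (nabla X mu).

Definition bas_torsion (mu nu : Gamma E) : Gamma E :=
  basE mu nu - basE nu mu - bracket LE mu nu.

Definition is_cartan : Prop := forall (mu nu : Gamma E) (X : Gamma F),
  nabla X (bracket LE mu nu) - bracket LE (nabla X mu) nu
    - bracket LE mu (nabla X nu) - nabla (basF nu X) mu
    + nabla (basF mu X) nu = 0.

Definition is_adjustment : Prop :=
  is_cartan /\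
  forall (X Y : Gamma F) (nu : Gamma E),
    curvature X Y nu =
      - basE nu (form2_sec zeta X Y) + form2_sec zeta (basF nu X) Y
      + form2_sec zeta X (basF nu Y).

Definition conn_zeta (X : Gamma F) (nu : Gamma E) : Gamma E :=
  nabla X nu - form2_sec zeta X (vbm_sec K nu).

Definition dform2 (D : Gamma F -> Gamma E -> Gamma E) (X Y Z : Gamma F) :
    Gamma E :=
  (D X (form2_sec zeta Y Z) - form2_sec zeta (bracket LF X Y) Z)
  + (D Y (form2_sec zeta Z X) - form2_sec zeta (bracket LF Y Z) X)
  + (D Z (form2_sec zeta X Y) - form2_sec zeta (bracket LF Z X) Y).

Definition is_strict_adjustment : Prop :=
  is_adjustment /\ forall X Y Z : Gamma F, dform2 conn_zeta X Y Z = 0.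

End Adjustments.

End LieAlgebroids.

(* Main.v *)
From HB Require Import structures.
Require Import Defs.
From mathcomp Require Import all_boot all_order all_algebra.
From mathcomp Require Import all_classical all_reals all_analysis.

(** The map [p : F (+) E -> F], [p (X, mu) = X + K mu], together with the
    projection to [E] determines a section of [F (+) E].  The first component
    of the bracket is chosen exactly so that [p] preserves brackets, and since
    [K] preserves anchors the anchor of the sum is [rho_F] composed with [p].
    Hence after [p] every Lie algebroid axiom becomes the same axiom of [F]
    ([dsum_to_F_bracket], [dsum_anchor_act]), the compatibility of anchor and
    bracket is inherited at once, and all that is left is the [E]-component
    of the other axioms.  Bilinearity, antisymmetry and the Leibniz rule are
    immediate there from those of [LE], of the connection and of the 2-form.

    For the Jacobi identity, the Jacobiator is additive in each argument and
    invariant under cyclic shifts, so it only has to vanish when each argument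
    lies in one of the two summands, and only for the four types of triples
    FFF, FFE, FEE, EEE ([jacobiator_split]).  On the summands the bracket is
    [[X, nu] = (- bas_nu X, nabla_X nu)], [[mu, nu] = (0, [mu, nu]_E)] and
    [[X, Y] = ([X, Y]_F - K (zeta (X, Y)), zeta (X, Y))].  Substituting, the
    [E]-components of the four Jacobiators are, in this order, the exterior
    derivative of [zeta] for the connection twisted by [zeta], the curvature
    equation of an adjustment, the Cartan condition, and the Jacobiator of
    [E]: the definition of a strict adjustment says precisely that the first
    three vanish.

    Projecting a section of the sum to a summand needs an argument:
    smoothness in the sum is tested only where trivialisations of both
    summands are defined, so the projection is smooth because smoothness is a
    local property ([smooth_on_local]). *)

Set Implicit Arguments.
Unset Strict Implicit.
Unset Printing Implicit Defensive.
Import GRing.Theory.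
Local Open Scope ring_scope.

(** * Smoothness is local *)

Section Local.
Context {R : realType}.

(** Each condition in [Ck] is imposed point by point, and the derivatives in it
    are those of the ambient space, whatever the set. *)
Lemma Ck_local (n k : nat) (O : set 'rV[R]_n) (f : 'rV[R]_n -> R) :
  (forall x, O x -> exists2 W, W x & Ck k W f) -> Ck k O f.
Proof.
elim: k f => [|k IH] f loc.
  by split=> // x /loc[W Wx [cf _]]; exact: cf.
split=> [x /loc[W Wx [cf _]]|i]; first exact: cf.
split=> [x /loc[W Wx [_ /(_ i)[df _]]]|]; first exact: df.
by apply: IH => x /loc[W Wx [_ /(_ i)[_ df]]]; exists W.
Qed.

Lemma smooth_on_local (M : manifold R) (U : set M) (f : M -> R) :
  (forall x, U x -> exists2 V, V x & smooth_on V f) -> smooth_on U f.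
Proof.
move=> loc c k; apply: Ck_local => _ [x [cx Ux] <-].
have [V Vx sf] := loc x Ux.
by exists (cmap c @` (cdom c `&` V))%classic; [exists x|exact: sf].
Qed.

End Local.

(** * Sections of a direct sum; linearity of tensors on sections *)

Section DirectSumSections.
Context {R : realType} {M : manifold R}.

Section Projections.
Context {F E : vbundle M}.
Implicit Types s t : Gamma (dsum F E).

(** A trivialisation of [F] alone is not one of the sum; near each point it
    becomes one after pairing it with some trivialisation of [E]. *)
Lemma smooth_sec_on_fst (U : set M) (s : forall x, dsum F E x) :
  smooth_sec_on U s -> smooth_sec_on U (fun x => (s x).1).
Proof.
move=> ss i k; apply: smooth_on_local => x [ix Ux].
have [j jx] := triv_cover E x.
exists (dsum_dom (i, j) `&` U)%classic => //.
have := ss (i, j) (lshift _ k); congr smooth_on; apply/funext => y.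
by rewrite /= /dsum_map row_mxEl.
Qed.

Lemma smooth_sec_on_snd (U : set M) (s : forall x, dsum F E x) :
  smooth_sec_on U s -> smooth_sec_on U (fun x => (s x).2).
Proof.
move=> ss j k; apply: smooth_on_local => x [jx Ux].
have [i ix] := triv_cover F x.
exists (dsum_dom (i, j) `&` U)%classic => //.
have := ss (i, j) (rshift _ k); congr smooth_on; apply/funext => y.
by rewrite /= /dsum_map row_mxEr.
Qed.

Definition sec_fst s : Gamma F := Section_ (smooth_sec_on_fst (secP s)).
Definition sec_snd s : Gamma E := Section_ (smooth_sec_on_snd (secP s)).

Fact sec_fst_linear : linear sec_fst.
Proof. by move=> f s t; apply: sec_eq. Qed.
HB.instance Definition _ := GRing.isLinear.Build _ _ _ _ sec_fst sec_fst_linear.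

Fact sec_snd_linear : linear sec_snd.
Proof. by move=> f s t; apply: sec_eq. Qed.
HB.instance Definition _ := GRing.isLinear.Build _ _ _ _ sec_snd sec_snd_linear.

Lemma sec_pairK1 (X : Gamma F) (mu : Gamma E) : sec_fst (sec_pair X mu) = X.
Proof. exact: sec_eq. Qed.

Lemma sec_pairK2 (X : Gamma F) (mu : Gamma E) : sec_snd (sec_pair X mu) = mu.
Proof. exact: sec_eq. Qed.

Lemma sec_pair_split s : s = sec_pair (sec_fst s) 0 + sec_pair 0 (sec_snd s).
Proof.
apply: sec_eq => x /=; rewrite [LHS]surjective_pairing.
by congr pair; rewrite ?addr0 ?add0r.
Qed.

End Projections.

Section Tensors.
Context {F E : vbundle M}.

Fact vbm_sec_linear (K : vbmorphism E F) : linear (vbm_sec K).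
Proof. by move=> f s t; apply: sec_eq => x /=; rewrite linearP. Qed.
HB.instance Definition _ (K : vbmorphism E F) :=
  GRing.isLinear.Build _ _ _ _ (vbm_sec K) (vbm_sec_linear K).

Fact form2_sec_linear (zeta : form2 F E) (X : Gamma F) :
  linear (form2_sec zeta X).
Proof. by move=> f s t; apply: sec_eq => x /=; rewrite form2_linearr. Qed.
HB.instance Definition _ (zeta : form2 F E) (X : Gamma F) :=
  GRing.isLinear.Build _ _ _ _ (form2_sec zeta X) (form2_sec_linear zeta X).

Lemma form2_secXX (zeta : form2 F E) (X : Gamma F) : form2_sec zeta X X = 0.
Proof. by apply: sec_eq => x /=; rewrite form2_alternating. Qed.

Lemma form2_secC (zeta : form2 F E) (X Y : Gamma F) :
  form2_sec zeta X Y = - form2_sec zeta Y X.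
Proof.
apply/eqP; rewrite -addr_eq0; apply/eqP.
have Dl Z : form2_sec zeta (X + Y) Z = form2_sec zeta X Z + form2_sec zeta Y Z.
  apply: sec_eq => x /=; have := form2_linearl zeta (Z x) 1 (X x) (Y x).
  by rewrite !scale1r.
have := form2_secXX zeta (X + Y).
by rewrite Dl !linearD/= !form2_secXX add0r addr0.
Qed.

Lemma form2_secNN (zeta : form2 F E) (X Y : Gamma F) :
  form2_sec zeta (- X) (- Y) = form2_sec zeta X Y.
Proof.
rewrite form2_secC (linearN (form2_sec zeta (- Y)))/= opprK.
by rewrite form2_secC (linearN (form2_sec zeta X))/= opprK.
Qed.

End Tensors.

End DirectSumSections.

(** * Elementary properties of brackets and connections *)

Section LieAlgebroidTheory.
Context {R : realType} {M : manifold R} {E : vbundle M} (L : lie_algebroid E).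

Fact bracket_additive (X : Gamma E) : zmod_morphism (bracket L X).
Proof.
have D Y Z : bracket L X (Y + Z) = bracket L X Y + bracket L X Z.
  exact: bracketDr.
by move=> Y Z; apply/eqP; rewrite eq_sym subr_eq -D subrK.
Qed.
HB.instance Definition _ (X : Gamma E) :=
  GRing.isZmodMorphism.Build _ _ (bracket L X) (bracket_additive X).

Lemma bracketC (X Y : Gamma E) : bracket L X Y = - bracket L Y X.
Proof.
apply/eqP; rewrite -addr_eq0; apply/eqP.
have := bracketXX L (X + Y).
by rewrite bracketDl !bracketDr !bracketXX add0r addr0.
Qed.

Section Connections.
Context {V : vbundle M} (nabla : connection L V).

Fact conn_additive (X : Gamma E) : zmod_morphism (nabla X).
Proof.
by move=> s t; apply/eqP; rewrite eq_sym subr_eq -connDr subrK.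
Qed.
HB.instance Definition _ (X : Gamma E) :=
  GRing.isZmodMorphism.Build _ _ (nabla X) (conn_additive X).

Lemma conn0l mu : nabla 0 mu = 0.
Proof. by have := connZl nabla 0 0 mu; rewrite !scale0r. Qed.

Lemma connNl X mu : nabla (- X) mu = - nabla X mu.
Proof. by rewrite -scaleN1r connZl scaleN1r. Qed.

End Connections.
End LieAlgebroidTheory.

(** * Jacobiators of biadditive operations *)

Lemma addr3ACA (V : nmodType) (a a' b b' c c' : V) :
  (a + a') + (b + b') + (c + c') = (a + b + c) + (a' + b' + c').
Proof. by rewrite (addrACA a) addrACA. Qed.

Section Jacobiator.
Context {V : zmodType} (b : V -> V -> V).
Hypotheses (bDl : forall u v w, b (u + v) w = b u w + b v w)
           (bDr : forall u v w, b u (v + w) = b u v + b u w).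

Definition jacobiator (u v w : V) := b u (b v w) + b v (b w u) + b w (b u v).

Lemma jacobiator_cyc u v w : jacobiator v w u = jacobiator u v w.
Proof. by rewrite /jacobiator addrC addrA. Qed.

Lemma jacobiatorD u u' v w :
  jacobiator (u + u') v w = jacobiator u v w + jacobiator u' v w.
Proof.
by rewrite /jacobiator !(bDl, bDr) addr3ACA.
Qed.

(** By triadditivity a Jacobiator splits into eight terms, and cyclic
    invariance reduces these to the four types below. *)
Lemma jacobiator_split (P Q : V -> Prop) :
    (forall v, exists p q, [/\ P p, Q q & v = p + q]) ->
    (forall p p' p'', P p -> P p' -> P p'' -> jacobiator p p' p'' = 0) ->
    (forall p p' q, P p -> P p' -> Q q -> jacobiator p p' q = 0) ->
    (forall p q q', P p -> Q q -> Q q' -> jacobiator p q q' = 0) ->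
    (forall q q' q'', Q q -> Q q' -> Q q'' -> jacobiator q q' q'' = 0) ->
  forall u v w, jacobiator u v w = 0.
Proof.
move=> split JPPP JPPQ JPQQ JQQQ u v w.
have D2 x y z t : jacobiator x (y + z) t = jacobiator x y t + jacobiator x z t.
  by rewrite -![jacobiator x _ t]jacobiator_cyc jacobiatorD.
have D3 x y z t : jacobiator x y (z + t) = jacobiator x y z + jacobiator x y t.
  by rewrite -![jacobiator x y _]jacobiator_cyc D2.
have [p [q [Pp Qq ->]]] := split u.
have [p' [q' [Pp' Qq' ->]]] := split v.
have [p'' [q'' [Pp'' Qq'' ->]]] := split w.
rewrite !(jacobiatorD, D2, D3).
have cyc x y z : jacobiator y z x = 0 -> jacobiator x y z = 0.
  by rewrite jacobiator_cyc.
rewrite (JPPP p p' p'')// (JPPQ p p' q'')// (JPQQ p q' q'')//.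
rewrite (JQQQ q q' q'')// (cyc q p' p'') ?(JPPQ p' p'' q)//.
rewrite (cyc q p' q'') ?(JPQQ p' q'' q)//.
rewrite (cyc p q' p'') ?(cyc q' p'' p) ?(JPPQ p'' p q')//.
rewrite (cyc q q' p'') ?(cyc q' p'' q) ?(JPQQ p'' q q')//.
by rewrite !addr0.
Qed.

End Jacobiator.

(** * The Lie algebroid structure on the direct sum *)

Section MatchedSum.
Context {R : realType} {M : manifold R} {E F : vbundle M}.
Variables (LE : lie_algebroid E) (LF : lie_algebroid F).
Variables (K : vbmorphism E F) (nabla : connection LF E) (zeta : form2 F E).

Definition snd_bracket (X : Gamma F) (mu : Gamma E) (Y : Gamma F)
    (nu : Gamma E) : Gamma E :=
  bracket LE mu nu + nabla X nu - nabla Y mu + form2_sec zeta X Y.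

Definition dsum_to_F (s : Gamma (dsum F E)) : Gamma F :=
  sec_fst s + vbm_sec K (sec_snd s).

Definition dsum_bracket (s t : Gamma (dsum F E)) : Gamma (dsum F E) :=
  let e := snd_bracket (sec_fst s) (sec_snd s) (sec_fst t) (sec_snd t) in
  sec_pair (bracket LF (dsum_to_F s) (dsum_to_F t) - vbm_sec K e) e.

Fact dsum_to_F_linear : linear dsum_to_F.
Proof.
move=> f s t; rewrite /dsum_to_F !linearP/= scalerDr.
by rewrite addrACA.
Qed.
HB.instance Definition _ :=
  GRing.isLinear.Build _ _ _ _ dsum_to_F dsum_to_F_linear.

(** [(p, snd)] is an automorphism of the sum, with inverse
    [(Z, mu) |-> (Z - K mu, mu)].  All axioms are checked through it. *)
Lemma dsum_sec_ext (s t : Gamma (dsum F E)) :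
  dsum_to_F s = dsum_to_F t -> sec_snd s = sec_snd t -> s = t.
Proof.
rewrite /dsum_to_F => + st2; rewrite st2 => /addIr st1.
by rewrite (sec_pair_split s) (sec_pair_split t) st1 st2.
Qed.

Lemma dsum_to_F_bracket s t :
  dsum_to_F (dsum_bracket s t) = bracket LF (dsum_to_F s) (dsum_to_F t).
Proof. by rewrite {1}/dsum_to_F sec_pairK1 sec_pairK2 subrK. Qed.

Lemma sec_snd_bracket s t : sec_snd (dsum_bracket s t) =
  snd_bracket (sec_fst s) (sec_snd s) (sec_fst t) (sec_snd t).
Proof. exact: sec_pairK2. Qed.

Lemma snd_bracketC X mu Y nu : snd_bracket X mu Y nu = - snd_bracket Y nu X mu.
Proof.
rewrite /snd_bracket bracketC form2_secC !opprD opprK.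
by rewrite (addrAC _ (nabla X nu)).
Qed.

(** The pairs [(- K mu, mu)] form the kernel of [dsum_to_F], which is closed
    under the bracket; so this [E]-component determines their bracket. *)
Lemma snd_bracket_kernel mu nu :
  snd_bracket (- vbm_sec K mu) mu (- vbm_sec K nu) nu =
    bas_torsion LE K nabla mu nu + form2_sec zeta (vbm_sec K mu) (vbm_sec K nu).
Proof.
rewrite /snd_bracket /bas_torsion /basE !connNl form2_secNN opprK.
congr (_ + _); rewrite (bracketC LE nu mu) opprD opprK.
by rewrite [RHS]addrC [RHS]addrA addKr addrC.
Qed.

Lemma dsum_bracketC s t : dsum_bracket s t = - dsum_bracket t s.
Proof.
apply: dsum_sec_ext; rewrite linearN/=.
  by rewrite !dsum_to_F_bracket bracketC.
by rewrite !sec_snd_bracket snd_bracketC.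
Qed.

Lemma dsum_bracketXX s : dsum_bracket s s = 0.
Proof.
apply: dsum_sec_ext; rewrite linear0.
  by rewrite dsum_to_F_bracket bracketXX.
by rewrite sec_snd_bracket /snd_bracket bracketXX form2_secXX add0r subrr addr0.
Qed.

Lemma dsum_bracketDr s t u :
  dsum_bracket s (t + u) = dsum_bracket s t + dsum_bracket s u.
Proof.
apply: dsum_sec_ext; rewrite linearD/=.
  by rewrite !dsum_to_F_bracket linearD bracketDr.
rewrite !sec_snd_bracket /snd_bracket !linearD/= bracketDr connDl connDr opprD.
by rewrite (addr3ACA (bracket _ _ _)) [LHS]addrACA.
Qed.

Lemma dsum_bracketDl s t u :
  dsum_bracket (s + t) u = dsum_bracket s u + dsum_bracket t u.
Proof. by rewrite dsum_bracketC dsum_bracketDr opprD -!dsum_bracketC. Qed.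

Definition dsum_anchor_val (x : M) (v : dsum F E x) : tangent x :=
  anchor LF x v.1 + anchor LE x v.2.

Fact dsum_anchor_linear x : linear (@dsum_anchor_val x).
Proof.
by move=> a u v; rewrite /dsum_anchor_val !linearP scalerDr addrACA.
Qed.
HB.instance Definition _ x :=
  GRing.isLinear.Build _ _ _ _ (@dsum_anchor_val x) (@dsum_anchor_linear x).

Fact dsum_anchor_smooth (U : set M) (s : forall x, dsum F E x) : open U ->
  smooth_sec_on U s -> smooth_field_on U (fun x => dsum_anchor_val (s x)).
Proof.
move=> oU ss f; apply: (smooth_onD oU).
  exact: anchor_smooth oU (smooth_sec_on_fst ss) f.
exact: anchor_smooth oU (smooth_sec_on_snd ss) f.
Qed.

Definition dsum_anchor : anchor_map (dsum F E) :=
  @AnchorMap R M (dsum F E) (fun x => @dsum_anchor_val x : {linear _ -> _})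
    dsum_anchor_smooth.

Hypothesis hK : is_la_morphism LE LF K.

(** This is where compatibility of [K] with the anchors enters: it turns the
    sum of the two anchors into the anchor of [F] composed with [dsum_to_F]. *)
Lemma dsum_anchor_act s f :
  anchor_act dsum_anchor s f = anchor_act (anchor LF) (dsum_to_F s) f.
Proof.
have [anchorK _] := hK.
by apply: sfun_eq => x /=; rewrite linearD /= anchorK.
Qed.

Lemma dsum_leibniz s f t : dsum_bracket s (f *: t) =
  f *: dsum_bracket s t + anchor_act dsum_anchor s f *: t.
Proof.
apply: dsum_sec_ext; rewrite linearP/=.
  by rewrite !dsum_to_F_bracket !linearZ/= bracket_leibniz dsum_anchor_act.
(* On the [E]-component the two summands of the anchor come from the bracket
   of [E] and from the connection, respectively. *)
have -> : anchor_act dsum_anchor s f =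
    anchor_act (anchor LE) (sec_snd s) f + anchor_act (anchor LF) (sec_fst s) f.
  by apply: sfun_eq => x /=; rewrite addrC.
rewrite !sec_snd_bracket /snd_bracket !linearZ/=.
rewrite bracket_leibniz conn_leibniz connZl.
rewrite !scalerDr scalerN [X in X - _]addrACA -scalerDl.
by set w := (_ + _) *: sec_snd t; rewrite (addrAC _ w) (addrAC _ w).
Qed.

Lemma dsum_anchor_bracket s t f :
  anchor_act dsum_anchor (dsum_bracket s t) f =
    anchor_act dsum_anchor s (anchor_act dsum_anchor t f)
    - anchor_act dsum_anchor t (anchor_act dsum_anchor s f).
Proof. by rewrite !dsum_anchor_act dsum_to_F_bracket anchor_bracket. Qed.

Lemma dsum_bracketZr (a : R) s t :
  dsum_bracket s (sfun_cst M a *: t) = sfun_cst M a *: dsum_bracket s t.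
Proof.
apply: dsum_sec_ext; rewrite linearZ/=.
  by rewrite !dsum_to_F_bracket linearZ bracketZr.
rewrite !sec_snd_bracket /snd_bracket !linearZ/= bracketZr connZl connZr.
by rewrite !scalerDr scalerN.
Qed.

Lemma dsum_bracketZl (a : R) s t :
  dsum_bracket (sfun_cst M a *: s) t = sfun_cst M a *: dsum_bracket s t.
Proof. by rewrite dsum_bracketC dsum_bracketZr -scalerN -dsum_bracketC. Qed.

(** Expanding [[X + K mu, Y + K nu]_F], the term [[K mu, K nu]_F] cancels
    against [K [mu, nu]_E] because [K] preserves brackets; the rest regroups
    into the basic connection on [F]. *)
Lemma dsum_bracket_pairE X mu Y nu :
  dsum_bracket (sec_pair X mu) (sec_pair Y nu) =
    sec_pair (bracket LF X Y + basF K nabla mu Y - basF K nabla nu X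
              - vbm_sec K (form2_sec zeta X Y))
      (snd_bracket X mu Y nu).
Proof.
have [_ bracketK] := hK.
rewrite /dsum_bracket /dsum_to_F !sec_pairK1 !sec_pairK2; congr sec_pair.
rewrite bracketDl !bracketDr -bracketK /snd_bracket /basF !linearD/= linearN/=.
rewrite (bracketC LF X (vbm_sec K nu)).
rewrite !opprK !addrA addrK.
by rewrite [LHS](ACl (1*3*5*2*4*6)).
Qed.

Local Notation inF X := (sec_pair X (0 : Gamma E)).
Local Notation inE mu := (sec_pair (0 : Gamma F) mu).

Lemma basF0r mu : basF K nabla mu 0 = 0.
Proof. by rewrite /basF raddf0 conn0l raddf0 addr0. Qed.

Lemma basF0l X : basF K nabla 0 X = 0.
Proof. by rewrite /basF raddf0 bracketC !raddf0 addr0. Qed.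

Lemma snd_bracketFl X Y nu :
  snd_bracket X 0 Y nu = nabla X nu + form2_sec zeta X Y.
Proof. by rewrite /snd_bracket bracketC !raddf0 add0r addr0. Qed.

Lemma snd_bracketEl mu Y nu :
  snd_bracket 0 mu Y nu = bracket LE mu nu - nabla Y mu.
Proof. by rewrite /snd_bracket conn0l form2_secC !raddf0 !addr0. Qed.

Lemma dsum_bracketFF X Y : dsum_bracket (inF X) (inF Y) =
  sec_pair (bracket LF X Y - vbm_sec K (form2_sec zeta X Y))
    (form2_sec zeta X Y).
Proof.
by rewrite dsum_bracket_pairE !basF0l addr0 subr0 snd_bracketFl raddf0 add0r.
Qed.

Lemma dsum_bracketFE X nu : dsum_bracket (inF X) (inE nu) =
  sec_pair (- basF K nabla nu X) (nabla X nu).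
Proof.
by rewrite dsum_bracket_pairE basF0l snd_bracketFl !raddf0 !(add0r, addr0).
Qed.

Lemma dsum_bracketEF mu Y : dsum_bracket (inE mu) (inF Y) =
  sec_pair (basF K nabla mu Y) (- nabla Y mu).
Proof.
rewrite dsum_bracket_pairE basF0l snd_bracketEl bracketC form2_secC !raddf0.
by rewrite !(add0r, addr0).
Qed.

Lemma dsum_bracketEE mu nu : dsum_bracket (inE mu) (inE nu) =
  inE (bracket LE mu nu).
Proof.
by rewrite dsum_bracket_pairE !basF0r snd_bracketEl conn0l !raddf0 !addr0.
Qed.

(** [dsum_to_F] preserves brackets, hence sends Jacobiators to Jacobiators of
    [F], which vanish; only the [E]-component is in question. *)
Lemma dsum_jacobiator_eq0 s t u :
  sec_snd (jacobiator dsum_bracket s t u) = 0 ->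
  jacobiator dsum_bracket s t u = 0.
Proof.
move=> J2; apply: dsum_sec_ext; rewrite linear0 //.
by rewrite /jacobiator !linearD/= !dsum_to_F_bracket bracket_jacobi.
Qed.

Hypothesis hadj : is_strict_adjustment LE K nabla zeta.

(** The [E]-component is the exterior derivative of [zeta] for [conn_zeta]: the
    correction [zeta (X, K _)] in [conn_zeta] is produced by the [F]-part
    [- K (zeta (Y, Z))] of the inner bracket. *)
Lemma dsum_jacobi_FFF X Y Z :
  jacobiator dsum_bracket (inF X) (inF Y) (inF Z) = 0.
Proof.
have [_ /(_ X Y Z)] := hadj; rewrite /dform2 /conn_zeta => strict.
apply: dsum_jacobiator_eq0; rewrite /jacobiator !linearD/= !dsum_bracketFF.
rewrite !sec_snd_bracket !sec_pairK1 !sec_pairK2 !snd_bracketFl !linearB/=.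
rewrite !(form2_secC _ _ (bracket LF _ _)) -{}[RHS]strict !addrA.
by rewrite [LHS](ACl (1*3*8*4*6*2*7*9*5)).
Qed.

(** The [E]-component is the difference of the two sides of the curvature
    equation of an adjustment. *)
Lemma dsum_jacobi_FFE X Y nu :
  jacobiator dsum_bracket (inF X) (inF Y) (inE nu) = 0.
Proof.
have [[_ /(_ X Y nu)/eqP + _]] := hadj.
rewrite -subr_eq0 /curvature /basE => /eqP adj.
apply: dsum_jacobiator_eq0; rewrite /jacobiator !linearD/=.
rewrite dsum_bracketFF (dsum_bracketFE Y) (dsum_bracketEF nu).
rewrite !sec_snd_bracket !sec_pairK1 !sec_pairK2 !snd_bracketFl snd_bracketEl.
rewrite connDl connNl !raddfN/= -{}[RHS]adj.
rewrite (form2_secC _ (basF K nabla nu X)) !opprD !opprK !addrA.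
by rewrite [LHS](ACl (1*3*6*5*7*4*2)).
Qed.

(** The [E]-component is the left-hand side of the Cartan condition. *)
Lemma dsum_jacobi_FEE X mu nu :
  jacobiator dsum_bracket (inF X) (inE mu) (inE nu) = 0.
Proof.
have [[/(_ mu nu X) cartan _] _] := hadj.
apply: dsum_jacobiator_eq0; rewrite /jacobiator !linearD/=.
rewrite dsum_bracketEE (dsum_bracketFE X mu) (dsum_bracketEF nu).
rewrite !sec_snd_bracket !sec_pairK1 !sec_pairK2 snd_bracketFl !snd_bracketEl.
rewrite connNl !raddfN/= raddf0 addr0 -{}[RHS]cartan opprK.
rewrite (bracketC LE nu) !addrA.
by rewrite [LHS](ACl (1*4*2*3*5)).
Qed.

Lemma dsum_jacobi_EEE la mu nu :
  jacobiator dsum_bracket (inE la) (inE mu) (inE nu) = 0.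
Proof.
apply: dsum_jacobiator_eq0; rewrite /jacobiator !linearD/=.
by rewrite !dsum_bracketEE !sec_pairK2 bracket_jacobi.
Qed.

Lemma dsum_jacobi s t u : jacobiator dsum_bracket s t u = 0.
Proof.
apply: (jacobiator_split dsum_bracketDl dsum_bracketDr
  (P := fun s => exists X, s = inF X) (Q := fun s => exists mu, s = inE mu)).
- move=> v; exists (inF (sec_fst v)), (inE (sec_snd v)).
  by split; [eexists|eexists|exact: sec_pair_split].
- by move=> _ _ _ [X ->] [Y ->] [Z ->]; exact: dsum_jacobi_FFF.
- by move=> _ _ _ [X ->] [Y ->] [nu ->]; exact: dsum_jacobi_FFE.
- by move=> _ _ _ [X ->] [mu ->] [nu ->]; exact: dsum_jacobi_FEE.
- by move=> _ _ _ [la ->] [mu ->] [nu ->]; exact: dsum_jacobi_EEE.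
Qed.

Definition matched_sum : lie_algebroid (dsum F E) :=
  LieAlgebroid dsum_bracketDl dsum_bracketDr dsum_bracketZl dsum_bracketZr
    dsum_bracketXX dsum_jacobi dsum_leibniz dsum_anchor_bracket.

End MatchedSum.

Theorem theorem3p1 (R : realType) (M : manifold R) (E F : vbundle M)
    (LE : lie_algebroid E) (LF : lie_algebroid F)
    (K : vbmorphism E F) (hK : is_la_morphism LE LF K)
    (nabla : connection LF E) (zeta : form2 F E)
    (hadj : is_strict_adjustment LE K nabla zeta) :
  exists LA : lie_algebroid (dsum F E),
    [/\ forall (x : M) (X : F x) (mu : E x),
          anchor LA x (X, mu) = anchor LF x X + anchor LE x mu,
        forall (X Y : Gamma F) (mu nu : Gamma E),
          bracket LA (sec_pair X mu) (sec_pair Y nu) =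
            sec_pair
              (bracket LF (X + vbm_sec K mu) (Y + vbm_sec K nu)
               - vbm_sec K (bracket LE mu nu + nabla X nu - nabla Y mu
                            + form2_sec zeta X Y))
              (bracket LE mu nu + nabla X nu - nabla Y mu
               + form2_sec zeta X Y),
        forall (X Y : Gamma F) (mu nu : Gamma E),
          bracket LA (sec_pair X mu) (sec_pair Y nu) =
            sec_pair
              (bracket LF X Y + basF K nabla mu Y - basF K nabla nu X
               - vbm_sec K (form2_sec zeta X Y))
              (bracket LE mu nu + nabla X nu - nabla Y mu
               + form2_sec zeta X Y)
      & forall mu nu : Gamma E,
          let H := bas_torsion LE K nabla mu nu
                   + form2_sec zeta (vbm_sec K mu) (vbm_sec K nu) in
          bracket LA (sec_pair (- vbm_sec K mu) mu)
                     (sec_pair (- vbm_sec K nu) nu) =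
            sec_pair (- vbm_sec K H) H].
Proof.
exists (matched_sum hK hadj); split=> // [X Y mu nu|X Y mu nu|mu nu].
- by rewrite /= /dsum_bracket /dsum_to_F !sec_pairK1 !sec_pairK2.
- exact: dsum_bracket_pairE.
rewrite /= /dsum_bracket /dsum_to_F !sec_pairK1 !sec_pairK2 !addNr raddf0 add0r.
by rewrite snd_bracket_kernel.
Qed.
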